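(* Let $\Gamma=(V,E,\mathrm{wt})$ be a finite edge-weighted directed multigraph, $\tilde\Gamma$ a $k$-fold cover of $\Gamma$, $v$ a vertex of $\Gamma$ with $A_v(\Gamma)\ne0$, and $\tilde v$ a lift of $v$ in $\tilde\Gamma$. If the edge weights of $\Gamma$ are (distinct) indeterminates, then the ratio $\dfrac{A_{\tilde v}(\tilde\Gamma)}{A_v(\Gamma)}$ is a homogeneous polynomial in the edge weights with integer coefficients.
   Context: Loops and multiple edges are allowed. $E_s(w)$ (resp. $E_t(w)$) is the set of edges with source (resp. target) $w$. An arborescence of a graph rooted at $v$ is a spanning tree directed towards $v$ (every vertex has a unique directed path to $v$ in the tree). Its weight is the product of its edge weights, and $A_v(\cdot)$ is the sum of weights of all arborescences rooted at $v$. The zero polynomial is regarded as homogeneous. A $k$-fold cover of $\Gamma$ is a graph $\tilde\Gamma=(\tilde V,\tilde E)$ with a map $\pi:\tilde\Gamma\to\Gamma$ sending vertices to vertices and edges to edges, compatible with sources and targets, such that $|\pi^{-1}(v)|=|\pi^{-1}(e)|=k$ for all $v\in V,e\in E$, $\mathrm{wt}(\tilde e)=\mathrm{wt}(\pi(\tilde e))$ for all $\tilde e\in\tilde E$, and $\pi$ is a local homeomorphism, i.e. $\pi$ restricts to bijections $E_s(\tilde v)\to E_s(\pi(\tilde v))$ and $E_t(\tilde v)\to E_t(\pi(\tilde v))$ for every $\tilde v\in\tilde V$. $\tilde\Gamma$ need not be connected. A lift of $v$ is an element of $\pi^{-1}(v)$. *)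

(* Defs.v *)
From HB Require Import structures.
From mathcomp Require Import all_boot all_order all_algebra.
From mathcomp Require Import boolp.
From mathcomp Require Import mpoly.

Set Implicit Arguments.
Unset Strict Implicit.
Unset Printing Implicit Defensive.

Import GRing.Theory.
Local Open Scope ring_scope.

Record wdigraph (R : Type) := WDigraph {
  vertex : finType;
  edge : finType;
  src : edge -> vertex;
  tgt : edge -> vertex;
  wt : edge -> R
}.

Definition Es (R : Type) (G : wdigraph R) (w : vertex G) : {set edge G} :=
  [set e | src e == w].

Definition Et (R : Type) (G : wdigraph R) (w : vertex G) : {set edge G} :=
  [set e | tgt e == w].

(* Walks are sequences of arcs, so that parallel edges give distinct walks. *)
Fixpoint walk (A : Type) (V : eqType) (s t : A -> V) (x : V) (p : seq A)
    (y : V) : bool :=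
  if p is a :: p' then (s a == x) && walk s t (t a) p' y else x == y.

(* A dart (e, b) is the edge e traversed forwards if b = false and backwards
   if b = true; undirected walks are walks of darts. *)
Definition dart (R : Type) (G : wdigraph R) : Type := (edge G * bool)%type.

Definition dsrc (R : Type) (G : wdigraph R) (d : dart G) : vertex G :=
  if d.2 then tgt d.1 else src d.1.

Definition dtgt (R : Type) (G : wdigraph R) (d : dart G) : vertex G :=
  if d.2 then src d.1 else tgt d.1.

Definition connected (R : Type) (G : wdigraph R) (T : {set edge G}) : Prop :=
  forall x y : vertex G, exists p : seq (dart G),
    all (fun d => d.1 \in T) p /\ walk (@dsrc R G) (@dtgt R G) x p y.

(* Undirected cycle; a loop is a cycle of length 1 and a pair of parallel (or
   antiparallel) edges is a cycle of length 2. *)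
Definition is_cycle (R : Type) (G : wdigraph R) (T : {set edge G})
    (x : vertex G) (c : seq (dart G)) : Prop :=
  [/\ (0 < size c)%N,
      all (fun d => d.1 \in T) c,
      walk (@dsrc R G) (@dtgt R G) x c x,
      uniq (map fst c)
    & uniq (map (@dsrc R G) c)].

Definition spanning_tree (R : Type) (G : wdigraph R) (T : {set edge G}) : Prop :=
  connected T /\ ~ (exists x c, is_cycle T x c).

Definition is_dpath (R : Type) (G : wdigraph R) (T : {set edge G})
    (x : vertex G) (p : seq (edge G)) (y : vertex G) : Prop :=
  [/\ all (fun e => e \in T) p,
      walk (@src R G) (@tgt R G) x p y
    & uniq (x :: map (@tgt R G) p)].

Definition arborescence (R : Type) (G : wdigraph R) (v : vertex G)
    (T : {set edge G}) : Prop :=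
  spanning_tree T /\ forall w : vertex G, exists! p, is_dpath T w p v.

Definition arb_sum (R : comNzRingType) (G : wdigraph R) (v : vertex G) : R :=
  \sum_(T : {set edge G} | `[< arborescence v T >]) \prod_(e in T) wt e.

Record kfold_cover (R : Type) (k : nat) (G' G : wdigraph R) := KFoldCover {
  piV : vertex G' -> vertex G;
  piE : edge G' -> edge G;
  pi_src : forall e, src (piE e) = piV (src e);
  pi_tgt : forall e, tgt (piE e) = piV (tgt e);
  card_fiberV : forall v, #|piV @^-1: [set v]| = k;
  card_fiberE : forall e, #|piE @^-1: [set e]| = k;
  pi_wt : forall e, wt e = wt (piE e);
  pi_Es_inj : forall w, {in Es w &, injective piE};
  pi_Es_img : forall w, piE @: Es w = Es (piV w);
  pi_Et_inj : forall w, {in Et w &, injective piE};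
  pi_Et_img : forall w, piE @: Et w = Et (piV w)
}.

(* Main.v *)
Require Import Defs.
From mathcomp Require Import all_boot all_order all_algebra.
From mathcomp Require Import fingroup perm boolp.
From mathcomp Require Import mpoly.

Set Implicit Arguments.
Unset Strict Implicit.
Unset Printing Implicit Defensive.

Import GRing.Theory.
Local Open Scope ring_scope.

(** Write L for the Laplacian of the graph G, with rows indexed by the sources
of the edges, and L' for that of its cover G'. The matrix-tree theorem,
[arb_sum_cofactor], says that every cofactor of L in row w equals A_w(G).

Let P be the 0/1 matrix that pulls functions on the vertices of G back to G'.
Out-edges lift bijectively, so L' P = P L. Adding the product of the column P e_v
with a unit row to L', and correspondingly a single diagonal entry to L, keeps
such an intertwining and turns the vanishing determinants into the sum of
A_u(G') over the lifts u of v and into A_v(G). As P can be completed to a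
unitriangular basis, the larger matrix is block triangular and its determinant
is A_v(G) times a determinant det M, whose entries are linear forms in the edge
weights ([sum_arb_lifts]).

In-edges lift bijectively too, so the row vector (A_w(G))_w, annihilated by L on
its right, pulls back to one annihilated by L'. Such a vector is proportional
to (A_u(G'))_u, by a Cramer type identity that assumes nothing on the rank
([left_null_proportional]); if A_v(G) is nonzero, all k lifts u of v therefore
have the same A_u(G') ([arb_sum_lift_eq]).

Hence k A_v'(G') = A_v(G) det M, where det M is homogeneous. Distinct
arborescences of G have distinct monomials when the weights are distinct
indeterminates, so A_v(G) has leading coefficient 1, and k has to divide every
coefficient of det M ([mpoly_dvd_content]). The ratio is det M / k. *)

(** * Determinants *)

Lemma eq_cofactor (R : comNzRingType) (n : nat) (A B : 'M[R]_n) (i j : 'I_n) :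
  (forall k l, k != i -> l != j -> A k l = B k l) ->
  cofactor A i j = cofactor B i j.
Proof.
move=> eqAB; congr (_ * \det _); apply/matrixP => k l.
by rewrite !mxE eqAB // eq_sym neq_lift.
Qed.

Lemma det_set_row (R : comNzRingType) (n : nat) (A : 'M[R]_n) (i0 : 'I_n)
    (y : 'I_n -> R) :
  \det (\matrix_(i, j) if i == i0 then y j else A i j) =
  \sum_j y j * cofactor A i0 j.
Proof.
rewrite (expand_det_row _ i0); apply: eq_bigr => j _; rewrite mxE eqxx.
by congr (_ * _); apply: eq_cofactor => k l /negPf ki _; rewrite mxE ki.
Qed.

Lemma det_add_col (R : comNzRingType) (n : nat) (A : 'M[R]_n) (j0 : 'I_n)
    (c : 'I_n -> R) :
  \det (\matrix_(i, j) (A i j + c i * (j == j0)%:R)) =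
  \det A + \sum_i c i * cofactor A i j0.
Proof.
rewrite (expand_det_col _ j0) (expand_det_col A j0) -big_split /=.
apply: eq_bigr => i _; rewrite mxE eqxx mulr1 -mulrDl; congr (_ * _).
by apply: eq_cofactor => k l _ /negPf lj; rewrite mxE lj mulr0 addr0.
Qed.

(** Over a ring with zero divisors a nonzero kernel vector is not enough: the
adjugate gives det A * x = 0, and an entry of x equal to 1 lets one conclude. *)
Lemma det_eq0_kernel (R : comNzRingType) (n : nat) (A : 'M[R]_n) (x : 'cV[R]_n)
    (i : 'I_n) :
  A *m x = 0 -> x i 0 = 1 -> \det A = 0.
Proof.
move=> Ax0 xi1; have := congr1 (mulmx (\adj A)) Ax0.
rewrite mulmxA mul_adj_mx mul_scalar_mx mulmx0 => /matrixP/(_ i 0).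
by rewrite !mxE xi1 mulr1.
Qed.

Lemma det_multilinear (R : comNzRingType) (n : nat) (J : finType)
    (Q : 'I_n -> pred J) (c : 'I_n -> J -> R) (F : J -> 'I_n -> 'I_n -> R) :
  \det (\matrix_(i, j) \sum_(a | Q i a) c i a * F a i j) =
  \sum_(f in family Q) (\prod_i c i (f i)) * \det (\matrix_(i, j) F (f i) i j).
Proof.
rewrite [LHS]/determinant.
under eq_bigr => s _.
  under eq_bigr => i _ do rewrite mxE.
  rewrite bigA_distr_big_dep big_distrr /=.
  over.
rewrite exchange_big; apply: eq_bigr => f _.
rewrite [X in _ * X]/determinant big_distrr; apply: eq_bigr => s _ /=.
under [X in _ = _ * (_ * X)]eq_bigr => i _ do rewrite mxE.
by rewrite big_split mulrCA.
Qed.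

(** A partial map seen as a functional graph: nilpotency means that every
trajectory leaves the domain, i.e. that the graph is a forest of in-trees. *)
Definition nilpotent_pmap (T : finType) (g : T -> option T) : Prop :=
  forall i, exists m, iter m (obind g) (Some i) = None.

(** The determinantal core of the matrix-tree theorem. If g is nilpotent, only
the identity contributes to the Leibniz formula, since a permutation s with a
moved point i and a nonzero product has g i = Some (s i) along the whole orbit of
i, which then never leaves the domain. Otherwise the indicator of the points
whose trajectory never ends is in the kernel. *)
Lemma det_id_sub_pmap (R : comNzRingType) (n : nat) (g : 'I_n -> option 'I_n) :
  \det (\matrix_(i, j) ((i == j)%:R - (g i == Some j)%:R : R)) =
  `[< nilpotent_pmap g >]%:R.
Proof.
case: asboolP => [nil_g | not_nil].
  rewrite [LHS]/determinant (bigD1 (1%g : 'S_n)) //= odd_perm1 expr0 mul1r.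
  rewrite big1 => [|i _].
    rewrite big1 ?addr0 // => s s_neq1.
    have [i s_i] : exists i, s i != i.
      apply/existsP; rewrite -negb_forall; apply: contraNN s_neq1.
      by move=> /forallP s_id; apply/eqP/permP => i; rewrite perm1; apply/eqP.
    have [/existsP[j /andP[sj gj]] | ] :=
      boolP [exists j, (s j != j) && (g j != Some (s j))].
      rewrite (bigD1 j) //= mxE eq_sym (negPf sj) (negPf gj).
      by rewrite subr0 mul0r mulr0.
    rewrite negb_exists => /forallP s_g; case: (nil_g i) => m.
    suff [j _ ->] : exists2 j, s j != j & iter m (obind g) (Some i) = Some j by [].
    elim: m => [|m [j sj /= ->]] /=; first by exists i.
    exists (s j); first by rewrite (inj_eq perm_inj).
    by apply/eqP; have := s_g j; rewrite sj negbK.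
  rewrite mxE perm1 eqxx; case: eqP => [gi|_]; last by rewrite subr0.
  case: (nil_g i) => m; suff ->: iter m (obind g) (Some i) = Some i by [].
  by elim: m => //= m ->.
have [i bad_i] : exists i, ~ exists m, iter m (obind g) (Some i) = None.
  exact/existsNP.
pose bad i := `[< ~ exists m, iter m (obind g) (Some i) = None >].
apply: (@det_eq0_kernel _ _ _ (\col_i (bad i)%:R) i); last first.
  by rewrite mxE /bad; case: asboolP.
(* The set of bad points and its complement are both stable under g, which is
   what makes the indicator a kernel vector. *)
have gE k : bad k = if g k is Some j then bad j else false.
  apply/asboolP/idP => [bad_k|].
    case gk: (g k) => [j|]; last by case: bad_k; exists 1%N; rewrite /= gk.
    by apply/asboolP => -[m mj]; case: bad_k; exists m.+1; rewrite iterSr /= gk.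
  case gk: (g k) => [j|] // /asboolP bad_j [[|m]] //.
  by rewrite iterSr /= gk => mj; apply: bad_j; exists m.
apply/matrixP => k l; rewrite !mxE.
under eq_bigr => j _ do rewrite !mxE mulrBl.
rewrite sumrB (bigD1 k) //= eqxx mul1r big1 ?addr0; last first.
  by move=> j /negPf jk; rewrite eq_sym jk mul0r.
rewrite gE; case gk: (g k) => [j|]; last first.
  by rewrite big1 ?subrr // => j _; rewrite mul0r.
rewrite (bigD1 j) //= eqxx mul1r big1 ?addr0 ?subrr // => j' /negPf jj.
by rewrite (inj_eq Some_inj) eq_sym jj mul0r.
Qed.

(** * Arborescences in terms of out-edges *)

Section Walks.
Variables (A : Type) (V : eqType) (s t : A -> V).

Lemma walk_last x p y : walk s t x p y -> y = last x (map t p).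
Proof. by elim: p x => [|a p IH] x /= => [/eqP | /andP[_ /IH]]. Qed.

Lemma walk_cat x p q y :
  walk s t x (p ++ q) y =
  walk s t x p (last x (map t p)) && walk s t (last x (map t p)) q y.
Proof. by elim: p x => [|a p IH] x /=; rewrite ?eqxx // IH andbA. Qed.

Lemma walk_mid x p y z : walk s t x p y -> z \in x :: map t p ->
  exists p1 p2, [/\ p = p1 ++ p2, walk s t x p1 z & walk s t z p2 y].
Proof.
elim: p x => [|a p IH] x.
  by rewrite mem_seq1 => /= w /eqP->; exists [::], [::]; rewrite /= eqxx.
move=> w; rewrite in_cons => /orP[/eqP-> | z_in].
  by exists [::], (a :: p); rewrite /= eqxx.
move: w => /= /andP[sa w]; case: (IH _ w z_in) => p1 [p2 [-> w1 w2]].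
by exists (a :: p1), p2; rewrite /= sa.
Qed.

Lemma closed_walk_perm x p : walk s t x p x -> perm_eq (map s p) (map t p).
Proof.
suff srcE y z : walk s t y p z -> rcons (map s p) z = y :: map t p.
  by move=> /srcE E; rewrite -(perm_cons x) -E perm_sym perm_rcons.
by elim: p y => [|e p IH] y /= => [/eqP-> // | /andP[/eqP-> /IH->]].
Qed.
End Walks.

Section Arborescence.
Variables (R : Type) (G : wdigraph R) (v : vertex G).
Implicit Types (T : {set edge G}) (x y w : vertex G).

Definition in_walk T x p y :=
  all (fun e => e \in T) p && walk (@src R G) (@tgt R G) x p y.

Lemma walk_darts (b : bool) x p y :
  walk (@src R G) (@tgt R G) x p y ->
  if b then walk (@dsrc R G) (@dtgt R G) y (rev (map (fun e => (e, true)) p)) x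
  else walk (@dsrc R G) (@dtgt R G) x (map (fun e => (e, false)) p) y.
Proof.
case: b; elim: p x => [|e p IH] x /=; do 1?[by move=> /eqP->].
  move=> /andP[/eqP <- /IH w]; rewrite rev_cons -cats1 walk_cat.
  by rewrite -(walk_last w) w /dsrc /dtgt /= !eqxx.
by move=> /andP[/eqP <- /IH w]; rewrite /dsrc /dtgt /= eqxx.
Qed.

(** If the simple path from [tgt e] to v came back to [src e], it would close up
to a cycle of the tree. *)
Lemma arborescence_cons T e : arborescence v T -> e \in T ->
  exists p, is_dpath T (src e) (e :: p) v.
Proof.
move=> [[_ acyc] dpath] eT; have [p [[pT wp up] _]] := dpath (tgt e).
exists p; split; rewrite /= ?eT ?eqxx //; apply/andP; split; last exact: up.
apply/negP => src_in; apply: acyc.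
have [p1 [p2 [pE w1 _]]] := walk_mid wp src_in.
have wc : walk (@src R G) (@tgt R G) (src e) (e :: p1) (src e) by rewrite /= eqxx.
have u1 : uniq (map (@tgt R G) (e :: p1)).
  by move: up; rewrite pE map_cat -cat_cons cat_uniq => /andP[].
exists (src e), (map (fun e => (e, false)) (e :: p1)); split => //.
- by move: pT; rewrite pE all_cat /= eT all_map => /andP[].
- exact: (walk_darts false wc).
- by rewrite -map_comp map_id; apply: map_uniq u1.
- by rewrite -map_comp -(perm_uniq (closed_walk_perm wc)) in u1 *.
Qed.

(** Sources are distinct along the edges of an undirected cycle in T. So the
cycle, having as many edges as vertices, contains an out-edge of each of its
vertices; the directed walk to v, which is forced, then never leaves the cycle,
although v has no out-edge. *)
Lemma acyclic_src T :
  {in T, forall e, src e != v} -> {in T &, injective (@src R G)} ->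
  (forall w, exists p, in_walk T w p v) -> ~ exists x c, is_cycle T x c.
Proof.
move=> T_v T_inj T_walk [x [c [c_gt0 cT wc uf us]]].
pose S := map (@dsrc R G) c.
have tgtS d : d \in c -> dtgt d \in S.
  by rewrite /S (perm_mem (closed_walk_perm wc)) => dc; apply: map_f.
have cover y : y \in S -> exists2 e, e \in T & src e = y /\ tgt e \in S.
  have sub : {subset map (fun d => src d.1) c <= S}.
    move=> _ /mapP[[e b] dc ->]; case: b dc => dc; last by apply/mapP; exists (e, false).
    exact: (tgtS _ dc).
  have u : uniq (map (fun d => src d.1) c).
    rewrite (map_comp (@src R G) fst) map_inj_in_uniq //.
    by move=> _ _ /mapP[d dc ->] /mapP[d' dc' ->]; apply: T_inj; apply: (allP cT).
  have size_eq : size S = size (map (fun d => src d.1) c) by rewrite !size_map.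
  have [_ eqS] := uniq_min_size u sub (eq_leq size_eq).
  rewrite -eqS => /mapP[[e b] dc ->]; exists e; first exact: (allP cT _ dc).
  split=> //; case: b dc => dc; last exact: (tgtS _ dc).
  by apply/mapP; exists (e, true).
have x0S : exists y, y \in S.
  by rewrite /S; case: (c) c_gt0 => // d c' _; exists (dsrc d); rewrite mem_head.
have [y yS] := x0S; have [p] := T_walk y.
elim: p y yS => [|e p IH] y yS /andP[/= pT].
  move=> /eqP yv; have [e eT [se _]] := cover y yS.
  by have := T_v e eT; rewrite se yv eqxx.
move=> /andP[/eqP se wp]; move: pT => /andP[eT pT].
have [e' e'T [se' te']] := cover y yS.
have ee : e = e' by apply: T_inj => //; rewrite se se'.
by rewrite -ee in te'; apply: (IH (tgt e)); rewrite /in_walk ?pT.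
Qed.

(** The form in which arborescences are counted: T selects at most one out-edge
per vertex, none at v, and following them leads to v. *)
Lemma arborescenceP T : arborescence v T <->
  [/\ {in T, forall e, src e != v}, {in T &, injective (@src R G)}
    & forall w, exists p, in_walk T w p v].
Proof.
split=> [arbT | [T_v T_inj T_walk]].
  have [_ dpath] := arbT; split.
  - move=> e eT; apply/eqP => sev; have [p dp] := arborescence_cons arbT eT.
    have [q [_ uq]] := dpath (src e).
    have := uq _ dp; rewrite (uq [::]) //.
    by split; rewrite //= sev.
  - move=> e e' eT e'T see'.
    have [p dp] := arborescence_cons arbT eT.
    have [p' dp'] := arborescence_cons arbT e'T.
    have [q [_ uq]] := dpath (src e).
    by rewrite -see' in dp'; have := uq _ dp; rewrite (uq _ dp') => -[].
  - by move=> w; have [p [[pT wp _] _]] := dpath w; exists p; rewrite /in_walk pT.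
(* Walks to v are forced at each step and v has no out-edge, so they are unique;
   in particular they are simple, since a loop could be cut out. *)
have walk_uniq w p q : in_walk T w p v -> in_walk T w q v -> p = q.
  elim: p w q => [|e p IH] w [|e' q] //= /andP[/= pT wp] /andP[/= qT wq].
  - move: qT wq => /andP[e'T _] /andP[/eqP sw _].
    by have := T_v _ e'T; rewrite sw wp.
  - move: pT wp => /andP[eT _] /andP[/eqP sw _].
    by have := T_v _ eT; rewrite sw wq.
  move: pT wp qT wq => /andP[eT pT] /andP[/eqP sw wp] /andP[e'T qT] /andP[/eqP sw' wq].
  have ee : e = e' by apply: T_inj => //; rewrite sw sw'.
  by rewrite -ee in wq *; congr (_ :: _); apply: (IH (tgt e)); rewrite /in_walk ?pT ?qT.
split; first (split; last exact: acyclic_src).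
  move=> x y; have [p /andP[pT wp]] := T_walk x; have [q /andP[qT wq]] := T_walk y.
  exists (map (fun e => (e, false)) p ++ rev (map (fun e => (e, true)) q)).
  rewrite all_cat all_rev !all_map pT qT; split=> //.
  have wp' := walk_darts false wp; rewrite walk_cat -(walk_last wp') wp'.
  exact: (walk_darts true wq).
move=> w; have [p /andP[pT wp]] := T_walk w; exists p; split; last first.
  by move=> q [qT wq _]; apply: (walk_uniq w); rewrite /in_walk ?pT ?qT.
split=> //; elim: p w pT wp => //= e p IH w /andP[eT pT] /andP[/eqP sw wp].
apply/andP; split; last exact: (IH (tgt e)).
apply/negP => w_in; have [p1 [p2 [pE _ w2]]] := walk_mid wp w_in.
have p2T : all (fun e => e \in T) p2 by move: pT; rewrite pE all_cat => /andP[].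
have : e :: p = p2 by apply: (walk_uniq w); rewrite /in_walk /= ?eT ?pT ?p2T ?sw ?eqxx.
by move/(congr1 size)/eqP; rewrite pE /= size_cat -addSn gtn_eqF // addSn ltnS leq_addl.
Qed.
End Arborescence.

(** * The Laplacian and the matrix-tree theorem *)

Definition lap (R : comNzRingType) (G : wdigraph R) (x y : vertex G) : R :=
  \sum_(e in Es x) wt e * ((x == y)%:R - (tgt e == y)%:R).

Definition lapmx (R : comNzRingType) (G : wdigraph R) (N : nat)
    (ix : 'I_N -> vertex G) : 'M[R]_N :=
  \matrix_(i, j) lap (ix i) (ix j).

(** The left action of the Laplacian involves the in-edges of z, and its
diagonal part the out-edges of z. *)
Lemma sum_lapE (R : comNzRingType) (G : wdigraph R) (a : vertex G -> R) (z : vertex G) :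
  \sum_y a y * lap y z =
  \sum_(e in Es z) a z * wt e - \sum_(e in Et z) a (src e) * wt e.
Proof.
transitivity (\sum_e (a (src e) * wt e *+ (e \in Es z) -
                      a (src e) * wt e *+ (e \in Et z))).
  rewrite [RHS](partition_big (@src _ G) predT) //=; apply: eq_bigr => y _.
  rewrite mulr_sumr; apply: eq_big => [e|e]; rewrite inE // => /eqP ey.
  by rewrite !inE ey mulrA mulrBr !mulr_natr.
rewrite sumrB [\sum_(e in Es z) _]big_mkcond [\sum_(e in Et z) _]big_mkcond.
congr (_ - _); apply: eq_bigr => e _; rewrite mulrb //.
by case: ifP => //; rewrite inE => /eqP->.
Qed.

Section MatrixTree.
Variables (R : comNzRingType) (G : wdigraph R) (N : nat).
Variables (ix : 'I_N -> vertex G) (ix' : vertex G -> 'I_N).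
Hypotheses (ixK : cancel ix ix') (ix'K : cancel ix' ix).
Implicit Types (f : {ffun 'I_N -> option (edge G)}) (T : {set edge G}).

Section Root.
Variable i0 : 'I_N.

(** The terms of the expanded determinant pick, in each row, one out-edge of the
corresponding vertex, and [None] in the row of the root, which is replaced by a
unit vector. *)
Definition allowed i : pred (option (edge G)) :=
  fun o => if o is Some e then (src e == ix i) && (i != i0) else i == i0.

Definition wt_choice (o : option (edge G)) : R := if o is Some e then wt e else 1.

Definition head_of (o : option (edge G)) : option 'I_N :=
  omap (fun e => ix' (tgt e)) o.

Definition chosen f : {set edge G} := [set e | f (ix' (src e)) == Some e].

Definition choice_of T : {ffun 'I_N -> option (edge G)} :=
  [ffun i => [pick e in T | src e == ix i]].

Lemma choice_none_root f i : f \in family allowed -> f i = None -> i = i0.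
Proof. by move=> /familyP/(_ i) + fi; rewrite fi => /eqP. Qed.

Lemma choice_someP f i e : f \in family allowed -> f i = Some e ->
  [/\ src e = ix i, i != i0 & e \in chosen f].
Proof.
move=> /familyP/(_ i) + fi; rewrite fi => /andP[/eqP se ->].
by rewrite inE se ixK fi.
Qed.

(** A walk to the root along chosen edges is a trajectory of the partial map
sending a vertex to the head of its chosen edge, defined off the root. *)
Lemma nilpotent_arborescence f : f \in family allowed ->
  `[< nilpotent_pmap (fun i => head_of (f i)) >] = `[< arborescence (ix i0) (chosen f) >].
Proof.
move=> f_fam; apply: asbool_equiv_eq; rewrite arborescenceP.
split=> [nil_f | [_ _ to_root] i].
  split.
  - move=> e; rewrite inE => /eqP /(choice_someP f_fam)[_ + _].
    by rewrite -[in X in _ -> X](ix'K (src e)) (inj_eq (can_inj ixK)).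
  - move=> e e'; rewrite !inE => /eqP fe /eqP fe' see.
    by apply: Some_inj; rewrite -fe -fe' see.
  move=> w; have [m] := nil_f (ix' w); rewrite -{2}[w]ix'K.
  elim: m (ix' w) => // m IH i; rewrite iterSr /=; case fi: (f i) => [e|] /=.
    have [se _ eT] := choice_someP f_fam fi.
    move=> /IH[p]; rewrite ix'K => /andP[pT wp]; exists (e :: p).
    by rewrite /in_walk /= eT pT se eqxx.
  by move=> _; exists [::]; rewrite /in_walk /= (choice_none_root f_fam fi) eqxx.
have [p] := to_root (ix i); elim: p i => [|e p IH] i /andP[/= pT].
  move=> /eqP /(can_inj ixK) ->; exists 1%N => /=.
  by case fi: (f i0) => [e|] //; have [_] := choice_someP f_fam fi; rewrite eqxx.
move=> /andP[/eqP se wp]; move: pT => /andP[].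
rewrite inE se ixK => /eqP fi pT.
have [|m mE] := IH (ix' (tgt e)); first by rewrite ix'K /in_walk pT.
by exists m.+1; rewrite iterSr /= fi.
Qed.

Lemma choice_ofK T : arborescence (ix i0) T -> chosen (choice_of T) = T.
Proof.
move=> /arborescenceP[T_v T_inj _]; apply/setP => e; rewrite inE ffunE ix'K.
case: pickP => [e' /andP[e'T /eqP se] | none].
  apply/eqP/idP => [[<-]//|eT]; congr Some; exact: T_inj.
by apply/esym/negbTE/negP => eT; have := none e; rewrite eT eqxx.
Qed.

Lemma choice_of_family T : arborescence (ix i0) T -> choice_of T \in family allowed.
Proof.
move=> /arborescenceP[T_v T_inj to_root]; apply/familyP => i.
rewrite ffunE unfold_in /=; case: pickP => [e /andP[eT /eqP se] | none] /=.
  rewrite se eqxx /=; apply: contraNneq (T_v _ eT) => <-; exact/eqP.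
have [[|e p] /andP[/= pT]] := to_root (ix i); first by move=> /eqP/(can_inj ixK)->.
by move: pT => /andP[eT _] /andP[se _]; have := none e; rewrite eT se.
Qed.

Lemma chosenK f : f \in family allowed -> choice_of (chosen f) = f.
Proof.
move=> f_fam; apply/ffunP => i; rewrite ffunE; case: pickP => [e|none].
  by rewrite inE => /andP[/eqP fe /eqP se]; rewrite -fe se ixK.
case fi: (f i) => [e|] //; have [se _ eT] := choice_someP f_fam fi.
by have := none e; rewrite eT se eqxx.
Qed.

Lemma prod_chosen f : f \in family allowed ->
  \prod_i wt_choice (f i) = \prod_(e in chosen f) wt e.
Proof.
move=> f_fam; rewrite (bigID (fun i => isSome (f i))) /= mulrC big1 ?mul1r; last first.
  by move=> i; rewrite /wt_choice; case: (f i).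
rewrite (reindex_omap (fun e => ix' (src e)) f) /=; last first.
  move=> i; case fi: (f i) => [e|] //= _.
  by have [-> _ _] := choice_someP f_fam fi; rewrite ixK.
apply: eq_big => [e | e /andP[_ /eqP->]] //.
by rewrite inE; case: (f _).
Qed.

(** Replacing row i0 by a unit vector and expanding every row over the out-edges
of its vertex writes the cofactor as a sum over choice functions; the
determinant left in each term tests whether the choice is an arborescence. *)
Lemma arb_sum_cofactor_diag : cofactor (lapmx ix) i0 i0 = arb_sum (ix i0).
Proof.
transitivity (\det (\matrix_(i, j) \sum_(o | allowed i o)
    wt_choice o * ((i == j)%:R - (head_of o == Some j)%:R))).
  transitivity (\sum_j (j == i0)%:R * cofactor (lapmx ix) i0 j).
    rewrite (bigD1 i0) //= eqxx mul1r big1 ?addr0 // => j /negPf->.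
    by rewrite mul0r.
  rewrite -det_set_row; congr (\det _); apply/matrixP => i j; rewrite !mxE.
  case: eqP => [-> | /eqP ne_i].
    rewrite (big_pred1 None) /= => [|[e|]]; rewrite /= ?eqxx ?andbF //.
    by rewrite mul1r subr0 eq_sym.
  rewrite (reindex_omap Some id); last by case; rewrite //= (negPf ne_i).
  apply: eq_big => e; first by rewrite inE eqxx /= ne_i !andbT.
  move=> _; rewrite /head_of /= (inj_eq Some_inj) (inj_eq (can_inj ixK)).
  by rewrite (can2_eq ix'K ixK).
rewrite (det_multilinear _ _ (fun o i j => (i == j)%:R - (head_of o == Some j)%:R)).
under eq_bigr => f f_fam.
  rewrite (det_id_sub_pmap _ (fun i => head_of (f i))) nilpotent_arborescence // prod_chosen //.
  over.
rewrite /arb_sum (reindex_onto chosen choice_of) /=; last first.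
  by move=> T /asboolP; apply: choice_ofK.
rewrite [RHS]big_mkcond [LHS]big_mkcond; apply: eq_bigr => f _.
have [f_fam|f_fam] := boolP (f \in family allowed).
  by rewrite chosenK // eqxx andbT; case: ifP; rewrite (mulr1, mulr0).
case: ifP => // /andP[/asboolP arbT /eqP fE].
by rewrite -fE choice_of_family in f_fam.
Qed.
End Root.

Lemma lap_row_sum x : \sum_j lap x (ix j) = 0.
Proof.
rewrite exchange_big big1 // => e _; rewrite -mulr_sumr sumrB.
suff sum1 y : \sum_j (y == ix j)%:R = 1 :> R by rewrite !sum1 subrr mulr0.
rewrite (bigD1 (ix' y)) //= ix'K eqxx big1 ?addr0 // => j /negPf jy.
by rewrite -(ix'K y) (inj_eq (can_inj ixK)) eq_sym jy.
Qed.

(** The difference of two cofactors of row i is the determinant with row i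
replaced by a difference of unit vectors; it vanishes since all rows then sum
to zero. *)
Lemma arb_sum_cofactor i j : cofactor (lapmx ix) i j = arb_sum (ix i).
Proof.
rewrite -arb_sum_cofactor_diag; apply/eqP; rewrite -subr_eq0; apply/eqP.
transitivity (\sum_k ((k == j)%:R - (k == i)%:R) * cofactor (lapmx ix) i k).
  under eq_bigr => k _ do rewrite mulrBl.
  rewrite sumrB; congr (_ - _).
    by rewrite (bigD1 j) //= eqxx mul1r big1 ?addr0 // => k /negPf->; rewrite mul0r.
  by rewrite (bigD1 i) //= eqxx mul1r big1 ?addr0 // => k /negPf->; rewrite mul0r.
rewrite -det_set_row; apply: (@det_eq0_kernel _ _ _ (const_mx 1) i); last by rewrite mxE.
apply/matrixP => k l; rewrite !mxE.
under eq_bigr => m _ do rewrite !mxE mulr1.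
case: eqP => _; last by rewrite lap_row_sum.
have sum1 (z : 'I_N) : \sum_m (m == z)%:R = 1 :> R.
  by rewrite (bigD1 z) //= eqxx big1 ?addr0 // => m /negPf->.
by rewrite sumrB !sum1 subrr.
Qed.

Lemma det_lapmx (i : 'I_N) : \det (lapmx ix) = 0.
Proof.
apply: (@det_eq0_kernel _ _ _ (const_mx 1) i); last by rewrite mxE.
apply/matrixP => k l; rewrite !mxE -[RHS](lap_row_sum (ix k)).
by apply: eq_bigr => j _; rewrite !mxE mulr1.
Qed.

Lemma det_lapmx_add_col (c : 'I_N -> R) (j0 : 'I_N) :
  \det (\matrix_(i, j) (lapmx ix i j + c i * (j == j0)%:R)) =
  \sum_i c i * arb_sum (ix i).
Proof.
rewrite det_add_col (det_lapmx j0) add0r; apply: eq_bigr => i _.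
by rewrite arb_sum_cofactor.
Qed.

Lemma arb_sum_left_null (y : vertex G) : \sum_x arb_sum x * lap x y = 0.
Proof.
rewrite (reindex ix) /=; last by exists ix' => ? _.
have := mul_adj_mx (lapmx ix); rewrite (det_lapmx (ix' y)).
move=> /matrixP/(_ (ix' y) (ix' y)).
rewrite !mxE mul0rn => E; rewrite -[RHS]E; apply: eq_bigr => i _.
by rewrite !mxE arb_sum_cofactor ix'K.
Qed.

(** Let B be L with 1 added to its diagonal entry at y, so det B = A_y. Then
x B = x_y e_y, and multiplying by the adjugate of B gives A_y x = x_y (A_z)_z,
because row y of the adjugate is not changed by the perturbation. *)
Lemma left_null_proportional (x : vertex G -> R) :
  (forall z : vertex G, \sum_y x y * lap y z = 0) ->
  forall y z, arb_sum y * x z = x y * arb_sum z.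
Proof.
move=> null_x y z; pose j0 := ix' y.
pose B := \matrix_(i, j) (lapmx ix i j + (i == j0)%:R * (j == j0)%:R).
have detB : \det B = arb_sum y.
  rewrite det_lapmx_add_col (bigD1 j0) //= eqxx mul1r ix'K big1 ?addr0 // => i /negPf->.
  by rewrite mul0r.
have xB : (\row_i x (ix i)) *m B = x y *: delta_mx 0 j0.
  apply/rowP => j; rewrite !mxE; under eq_bigr => i _ do rewrite !mxE mulrDr.
  rewrite big_split /=.
  have -> : \sum_i x (ix i) * lap (ix i) (ix j) = 0.
    rewrite -[RHS](null_x (ix j)) [RHS](reindex ix) //=.
    by exists ix' => ? _.
  rewrite add0r (bigD1 j0) //= eqxx mul1r ix'K big1 ?addr0 // => i /negPf->.
  by rewrite mul0r mulr0.
have := congr1 (fun r => (r *m \adj B) 0 (ix' z)) xB.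
rewrite -mulmxA mul_mx_adj detB mul_mx_scalar -scalemxAl -rowE !mxE.
rewrite ix'K => ->; congr (_ * _); rewrite -[in RHS](ix'K z) -(arb_sum_cofactor _ j0).
by apply: eq_cofactor => k l _ /negPf lj; rewrite !mxE lj mulr0 addr0.
Qed.
End MatrixTree.

(** * Laplacians of covers *)

(** Conjugating B by the unipotent matrix whose first m columns are those of
[col_mx 1%:M Z] makes it block upper triangular with diagonal blocks C and the
quotient action. *)
Lemma det_intertwine (R : comNzRingType) (m n : nat) (B : 'M[R]_(m + n))
    (C : 'M[R]_m) (Z : 'M[R]_(n, m)) :
  B *m col_mx 1%:M Z = col_mx 1%:M Z *m C ->
  \det B = \det C * \det (drsubmx B - Z *m ursubmx B).
Proof.
rewrite -{1}[B]submxK mul_block_col mul_col_mx !mulmx1 mul1mx.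
move=> /eq_col_mx[BZ1 BZ2].
have uni (Z' : 'M[R]_(n, m)) : \det (block_mx 1%:M 0 Z' 1%:M) = 1.
  by rewrite det_lblock !det1 mulr1.
rewrite -(det_ublock C (ursubmx B)) -[LHS]mulr1 -[X in _ * X = _](uni Z).
rewrite -[\det B]mul1r -[X in X * \det B](uni (- Z)) -!det_mulmx -mulmxA.
congr (\det _); rewrite -{1}[B]submxK !mulmx_block.
rewrite !mulmx0 !mulmx1 !mul0mx !mul1mx ?addr0 ?add0r BZ1 BZ2.
by rewrite !mulNmx addNr [- _ + _]addrC.
Qed.

Section Cover.
Variables (R : comNzRingType) (k : nat) (G' G : wdigraph R).
Variable pi : kfold_cover k G' G.

Lemma sum_Es_lift (x : vertex G') (h : edge G -> R) :
  \sum_(e in Es (piV pi x)) h e = \sum_(e in Es x) h (Defs.piE pi e).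
Proof. by rewrite -pi_Es_img big_imset //; apply: pi_Es_inj. Qed.

Lemma sum_Et_lift (x : vertex G') (h : edge G -> R) :
  \sum_(e in Et (piV pi x)) h e = \sum_(e in Et x) h (Defs.piE pi e).
Proof. by rewrite -pi_Et_img big_imset //; apply: pi_Et_inj. Qed.

Lemma lap_push (x : vertex G') (w : vertex G) :
  \sum_y lap x y * (piV pi y == w)%:R = lap (piV pi x) w.
Proof.
rewrite [RHS]sum_Es_lift; under eq_bigr => y _ do rewrite mulr_suml.
rewrite exchange_big; apply: eq_bigr => e _ /=.
have sum1 z : \sum_y (z == y)%:R * (piV pi y == w)%:R = (piV pi z == w)%:R :> R.
  rewrite (bigD1 z) //= eqxx mul1r big1 ?addr0 // => y /negPf yz.
  by rewrite eq_sym yz mul0r.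
rewrite -(pi_wt pi) pi_tgt -!sum1 -sumrB mulr_sumr; apply: eq_bigr => y _.
by rewrite -mulrA mulrBl.
Qed.

Lemma left_null_lift (a : vertex G -> R) (y : vertex G') :
  \sum_x a (piV pi x) * lap x y = \sum_w a w * lap w (piV pi y).
Proof.
rewrite !sum_lapE sum_Es_lift sum_Et_lift.
by congr (_ - _); apply: eq_bigr => e _; rewrite ?pi_src (pi_wt pi).
Qed.

(** The vertices of G' are listed with a section of the cover first, so that the
pull-back matrix has the shape required by [det_intertwine]. The perturbing
column sits at the lift of v in the section, hence M, the action on the quotient,
involves the entries of the Laplacian only. *)
Lemma sum_arb_lifts (v : vertex G) : (0 < k)%N ->
  exists (m : nat) (M : 'M[R]_m),
    (forall i j, exists x x' y : vertex G', M i j = lap x y - lap x' y) /\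
    \sum_(x | piV pi x == v) arb_sum x = arb_sum v * \det M.
Proof.
move=> k_gt0; have lift w : {x | piV pi x == w}.
  apply: sigW; have : (0 < #|piV pi @^-1: [set w]|)%N by rewrite card_fiberV.
  by move=> /card_gt0P[x]; rewrite !inE; exists x.
pose sec w := sval (lift w).
have secK w : piV pi (sec w) = w by apply/eqP; apply: svalP (lift w).
pose rest := ~: (sec @: setT).
pose ix (i : 'I_(#|vertex G| + #|rest|)) : vertex G' :=
  match split i with inl i => sec (enum_val i) | inr j => enum_val j end.
have ixl i : ix (lshift _ i) = sec (enum_val i) by rewrite /ix (unsplitK (inl _)).
have ixr j : ix (rshift _ j) = enum_val j by rewrite /ix (unsplitK (inr _)).
have ix_inj : injective ix.
  have ix_lr i j : ix (lshift _ i) <> ix (rshift _ j).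
    move=> E; have := enum_valP j; rewrite -ixr -E ixl inE.
    by rewrite imset_f.
  move=> i j; case: (split_ordP i) => i' ->; case: (split_ordP j) => j' -> //.
  - by rewrite !ixl => /(can_inj secK)/enum_val_inj->.
  - by move/ix_lr.
  - by move/esym/ix_lr.
  - by rewrite !ixr => /enum_val_inj->.
have [|ix' ixK ix'K] := inj_card_bij ix_inj.
  by rewrite card_ord -[#|vertex G|]cardsT -(card_imset _ (can_inj secK)) cardsC.
pose j1 := enum_rank v.
pose P := \matrix_(i, j) (piV pi (ix i) == enum_val j)%:R : 'M[R]_(_, #|vertex G|).
pose c i : R := (piV pi (ix i) == v)%:R.
pose B := \matrix_(i, j) (lapmx ix i j + c i * (j == lshift _ j1)%:R).
pose C := \matrix_(i, j) (lapmx (@enum_val (vertex G) predT) i j +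
                         (i == j1)%:R * (j == j1)%:R).
(* On the section the pull-back matrix is the identity, because each vertex of G
   has a single lift there. *)
have PE : P = col_mx 1%:M (dsubmx P).
  rewrite -{1}[P]vsubmxK; congr col_mx; apply/matrixP => i j; rewrite !mxE ixl secK.
  by rewrite (inj_eq enum_val_inj).
have mulP q (D : 'M_(_, q)) i j : (P *m D) i j = D (enum_rank (piV pi (ix i))) j.
  rewrite mxE (bigD1 (enum_rank (piV pi (ix i)))) //= mxE enum_rankK eqxx mul1r.
  rewrite big1 ?addr0 // => l ne; rewrite mxE -(enum_rankK (piV pi (ix i))).
  by rewrite (inj_eq enum_val_inj) eq_sym (negPf ne) mul0r.
(* Entrywise, this says that the Laplacian commutes with pull-back and that the
   added column is the pull-back of the unit vector at v. *)
have BP : B *m P = P *m C.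
  apply/matrixP => i j; rewrite mulP mxE.
  under eq_bigr => l _ do rewrite !mxE mulrDl.
  rewrite big_split !mxE enum_rankK /=; congr (_ + _).
    rewrite -lap_push [RHS](reindex ix) //=.
    by exists ix' => ? _.
  rewrite (bigD1 (lshift _ j1)) //= eqxx mulr1 big1 ?addr0 => [|l /negPf->].
    rewrite ixl secK /c -(inj_eq enum_rank_inj) /j1 enum_rankK.
    by rewrite -[in X in _ * X](inj_eq enum_rank_inj) enum_valK [_ == j]eq_sym.
  by rewrite mulr0 mul0r.
exists #|rest|, (drsubmx B - dsubmx P *m ursubmx B); split.
  move=> i j; exists (ix (rshift _ i)), (sec (piV pi (ix (rshift _ i)))), (ix (rshift _ j)).
  rewrite !mxE eq_sym eq_lrshift mulr0 addr0; congr (_ - _).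
  transitivity ((P *m ursubmx B) (rshift _ i) j).
    by rewrite !mxE; apply: eq_bigr => l _; rewrite !mxE.
  rewrite mulP !mxE eq_sym eq_lrshift mulr0 addr0.
  by rewrite ixl enum_rankK.
transitivity (\det B).
  rewrite (det_lapmx_add_col ixK ix'K) [LHS]big_mkcond (reindex ix) /=.
    by apply: eq_bigr => i _; rewrite /c; case: ifP; rewrite (mul1r, mul0r).
  by exists ix' => ? _.
rewrite (@det_intertwine _ _ _ B C (dsubmx P)) -?PE //; congr (_ * _).
rewrite (det_lapmx_add_col (@enum_valK _) (@enum_rankK _)) (bigD1 j1) //= eqxx mul1r.
by rewrite enum_rankK big1 ?addr0 // => i /negPf->; rewrite mul0r.
Qed.
End Cover.

Lemma arb_sum_lift_eq (R : idomainType) (k : nat) (G' G : wdigraph R)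
    (pi : kfold_cover k G' G) (x y : vertex G') :
  piV pi x = piV pi y -> arb_sum (piV pi x) != 0 -> arb_sum x = arb_sum y.
Proof.
move=> xy A_neq0.
have null z : \sum_u arb_sum (piV pi u) * lap u z = 0.
  by rewrite left_null_lift (arb_sum_left_null (@enum_valK _) (@enum_rankK _)).
have := left_null_proportional (@enum_valK _) (@enum_rankK _) null x y.
by rewrite -xy mulrC => /(mulfI A_neq0).
Qed.

(** * Integrality and homogeneity *)

(** A case of Gauss's lemma. Writing q = k r + s with the coefficients of s
reduced modulo k, the leading coefficient of s is that of A s = k (B - A r), so
it is both reduced and divisible by k, and s = 0. *)
Lemma mpoly_dvd_content (n : nat) (A B q : {mpoly int[n]}) (k : int) :
  k != 0 -> mleadc A = 1 -> k *: B = A * q -> exists2 r, q = k *: r & B = A * r.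
Proof.
move=> k_neq0 A1 BAq.
pose r := \sum_(m <- msupp q) (q@_m %/ k)%Z *: 'X_[m].
pose s := \sum_(m <- msupp q) (q@_m %% k)%Z *: 'X_[m].
have qE : q = k *: r + s.
  rewrite {1}[q]mpolyE scaler_sumr -big_split; apply: eq_bigr => m _ /=.
  by rewrite scalerA -scalerDl mulrC -divz_eq.
have A_neq0 : A != 0 by rewrite -mleadc_eq0 A1.
have sE m : s@_m = (s@_m %% k)%Z.
  have -> : s@_m = (q@_m %% k)%Z.
    rewrite raddf_sum /=; have [mq | mq] := boolP (m \in msupp q).
      rewrite (bigD1_seq m) //= big1 ?addr0 => [|m' /negPf mm].
        by rewrite mcoeffZ mcoeffX eqxx mulr1.
      by rewrite mcoeffZ mcoeffX mm mulr0.
    rewrite (memN_msupp_eq0 mq) mod0z big1_seq // => m' /= m'q.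
    by rewrite mcoeffZ mcoeffX; case: eqP m'q mq => [->->|]; rewrite ?mulr0.
  by rewrite modz_mod.
suff s0 : s = 0.
  exists r; first by rewrite {1}qE s0 addr0.
  apply/eqP; rewrite -subr_eq0; have := BAq; rewrite qE s0 addr0 -scalerAr => /eqP.
  by rewrite -subr_eq0 -scalerBr -mul_mpolyC mulf_eq0 mpolyC_eq0 (negPf k_neq0).
apply/eqP; rewrite -mleadc_eq0 sE; apply/eqP/dvdz_mod0P.
rewrite -[mleadc s]mul1r -A1 -mleadcM.
have -> : A * s = k *: (B - A * r).
  by rewrite scalerBr BAq scalerAr -mulrBr {1}qE addrC addKr.
by rewrite mcoeffZ dvdz_mulr.
Qed.

Lemma dhomog_det (n m : nat) (R : comNzRingType) (M : 'M[{mpoly R[n]}]_m) :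
  (forall i j, M i j \is 1.-homog) -> \det M \is m.-homog.
Proof.
move=> M1; apply: rpred_sum => s _; rewrite rpredMsign.
suff prod_homog l (F : 'I_l -> {mpoly R[n]}) :
  (forall i, F i \is 1.-homog) -> \prod_i F i \is l.-homog by apply: prod_homog.
elim: l F => [|l IH] F F1; first by rewrite big_ord0 dhomog1.
by rewrite big_ord_recl; apply: (@dhomogM _ _ _ 1 _ l) => //; apply: IH.
Qed.

(** Since edges carry distinct indeterminates, an arborescence is determined by
its monomial, and all coefficients of the sum are 0 or 1. *)
Lemma mleadc_arb_sum (n : nat) (G : wdigraph {mpoly int[n]}) (X : edge G -> 'I_n)
    (v : vertex G) :
  injective X -> (forall e : edge G, wt e = 'X_(X e)) ->
  arb_sum v != 0 -> mleadc (arb_sum v) = 1.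
Proof.
move=> X_inj wtX; rewrite -mleadc_eq0; move: (mlead _) => m.
pose mon (T : {set edge G}) := (\sum_(e in T) U_(X e))%MM.
have mon_inj : injective mon.
  suff monE T e : (mon T) (X e) = (e \in T).
    move=> T T' E; apply/setP => e.
    have := congr1 (fun m : 'X_{1..n} => m (X e)) E; rewrite !monE.
    by do 2 case: (_ \in _).
  rewrite mnm_sumE; have [eT | eT] := boolP (e \in T).
    rewrite (bigD1 e) //= mnm1E eqxx big1 // => e' /andP[_ ne].
    by rewrite mnm1E (inj_eq X_inj) (negPf ne).
  rewrite big1 // => e' e'T; rewrite mnm1E (inj_eq X_inj).
  by case: eqP e'T eT => [->->|].
have -> : (arb_sum v)@_m =
    \sum_(T : {set edge G} | `[< arborescence v T >]) (mon T == m)%:R.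
  rewrite raddf_sum; apply: eq_bigr => T _ /=.
  by under eq_bigr => e _ do rewrite wtX; rewrite mprodXE mcoeffX.
have [T /andP[arbT /eqP mT] | none] :=
    pickP [pred T : {set edge G} | `[< arborescence v T >] && (mon T == m)].
  move=> _; rewrite (bigD1 T) //= mT eqxx big1 ?addr0 // => T' /andP[_ ne].
  by rewrite -mT (inj_eq mon_inj) (negPf ne).
by rewrite big1 ?eqxx // => T arbT; have := none T; rewrite /= arbT /= => ->.
Qed.

Theorem corollary1p6 (n k : nat) (G G' : wdigraph {mpoly int[n]})
    (X : edge G -> 'I_n) (bij_X : bijective X)
    (wt_indet : forall e : edge G, wt e = 'X_(X e))
    (pi : kfold_cover k G' G)
    (v : vertex G) (Av_neq0 : arb_sum v != 0)
    (v' : vertex G') (lift_v : piV pi v' = v) :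
  exists (p : {mpoly int[n]}) (d : nat),
    p \is d.-homog /\
    tofrac (arb_sum v') / tofrac (arb_sum v) = tofrac p.
Proof.
have k_gt0 : (0 < k)%N.
  by rewrite -(card_fiberV pi v); apply/card_gt0P; exists v'; rewrite !inE lift_v.
have [m [M [M_lap sumM]]] := sum_arb_lifts pi v k_gt0.
have lap_homog (x y : vertex G') : lap x y \is 1.-homog.
  apply: rpred_sum => e _; rewrite mulrBr !mulr_natr.
  by rewrite rpredB ?rpredMn ?(pi_wt pi) ?wt_indet ?dhomogX /= ?mdeg1.
have M_homog : \det M \is m.-homog.
  by apply: dhomog_det => i j; have [x [x' [y ->]]] := M_lap i j; rewrite rpredB.
have kA : k%:Z *: arb_sum v' = arb_sum v * \det M.
  rewrite -sumM (eq_bigr (fun=> arb_sum v')) => [|x /eqP xv]; last first.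
    by apply: (arb_sum_lift_eq (pi := pi)); rewrite xv ?lift_v.
  have -> : \sum_(x | piV pi x == v) arb_sum v' = arb_sum v' *+ k.
    rewrite sumr_const; congr (_ *+ _); rewrite -[RHS](card_fiberV pi v).
    by apply: eq_card => x; rewrite !inE.
  by rewrite -scaler_nat natz.
have k_neq0 : k%:Z != 0 by rewrite -lt0n.
have [p MkP A'E] := mpoly_dvd_content k_neq0
  (mleadc_arb_sum (bij_inj bij_X) wt_indet Av_neq0) kA.
exists p, m; split; last by rewrite A'E tofracM mulrAC divff ?mul1r // tofrac_eq0.
apply/dhomogP => mm; rewrite mcoeff_msupp => pm; apply: (dhomog_mf M_homog).
by rewrite mcoeff_msupp MkP mcoeffZ mulf_neq0.
Qed.
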